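(* For every constant $c>0$ and every countable family $\mathcal{F}$ of $c$-factorial graph classes, there exists a monotone tiny graph class that is not contained in any of the classes in $\mathcal{F}$.
   Context: A graph class is a set of finite simple graphs closed under isomorphism. A class is monotone if closed under taking subgraphs, hereditary if closed under taking induced subgraphs. A class is tiny if it is hereditary and there is a constant $\gamma$ such that for every $n$ it contains at most $\gamma^n$ unlabeled (up to isomorphism) $n$-vertex graphs. For a constant $c>0$, a hereditary class is $c$-factorial if for every $n\in\mathbb{N}$ the number of labeled $n$-vertex graphs (graphs on vertex set $[n]$, not identified up to isomorphism) in it is at most $n^{cn}$. *)

(* Defs.v *)
From mathcomp Require Import all_boot all_fingroup.
From Stdlib Require Import Reals.
Set Implicit Arguments. Unset Strict Implicit. Unset Printing Implicit Defensive.

Definition graph (n : nat) := {ffun 'I_n * 'I_n -> bool}.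

Definition simple n (g : graph n) : Prop :=
  forall i j : 'I_n, g (i, j) = g (j, i) /\ g (i, i) = false.

(* Pull back a graph on 'I_n along a map 'I_m -> 'I_n
   (for f injective: the induced subgraph on the image, relabeled by f). *)
Definition pullback m n (f : 'I_m -> 'I_n) (g : graph n) : graph m :=
  [ffun p : 'I_m * 'I_m => g (f p.1, f p.2)].

Definition gset := forall n : nat, graph n -> bool.

Definition graph_class (C : gset) : Prop :=
  (forall n g, C n g -> simple g) /\
  (forall n (s : {perm 'I_n}) (g : graph n), C n g -> C n (pullback s g)).

Definition hereditary (C : gset) : Prop :=
  graph_class C /\
  forall m n (f : 'I_m -> 'I_n) (g : graph n),
    injective f -> C n g -> C m (pullback f g).

Definition monotone (C : gset) : Prop :=
  graph_class C /\
  forall m n (f : 'I_m -> 'I_n) (g : graph n) (h : graph m),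
    injective f -> simple h ->
    (forall i j : 'I_m, h (i, j) -> g (f i, f j)) ->
    C n g -> C m h.

Definition iso n (g h : graph n) : bool :=
  [exists s : {perm 'I_n}, h == pullback s g].

Definition labeled_count (C : gset) (n : nat) : nat :=
  #|[set g : graph n | C n g]|.

Definition unlabeled_count (C : gset) (n : nat) : nat :=
  #|[set [set h : graph n | C n h & iso g h] | g in [set g : graph n | C n g]]|.

Definition tiny (C : gset) : Prop :=
  hereditary C /\
  exists gamma : R, forall n : nat, (INR (unlabeled_count C n) <= gamma ^ n)%R.

Definition c_factorial (c : R) (C : gset) : Prop :=
  hereditary C /\
  forall n : nat, (INR (labeled_count C n) <= Rpower (INR n) (c * INR n))%R.

Definition subclass (C D : gset) : Prop := forall n (g : graph n), C n g -> D n g.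

(* Main.v *)
Require Import Defs.
From mathcomp Require Import all_boot all_fingroup.
From Stdlib Require Import Reals.
From Stdlib Require Import ClassicalEpsilon Lra.
From mathcomp Require Import zify.
Import ssrnat.
Set Implicit Arguments. Unset Strict Implicit. Unset Printing Implicit Defensive.

(** Fix [K > c] and [d = 4K]. Call a graph of maximum degree at most [d] good for [L] if every
    nonempty set [S] of at most [L] vertices spans at most [|S| - 1] edges. On [N = B^L] vertices,
    with [B] a large constant, good graphs can be built greedily: as long as there are fewer than
    [KN] edges, joining two vertices of degree less than [d] at distance more than [L] is allowed,
    and there are at least [N^2 / 8] such ordered pairs. Double counting the pairs (graph, new edge)
    yields more than [N^(cN)] good graphs, so each class of the family misses one of them.

    Pick such hosts [G_i] with [L_(i+1) > B^(L_i)], and let the class consist of their subgraphs.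
    For a given [n] at most one [i] has [L_i <= n <= B^(L_i)]; the [n]-vertex subgraphs of all other
    hosts are forests. To count subgraphs of a host up to isomorphism, order the vertices by
    breadth-first search. A forest is determined by its monotone parent function, hence 4^n of them.
    In general, components with fewer than [L] vertices are still trees, and a larger component is
    determined by the image of its root in the host together with boundedly many bits per vertex.
    There are at most [n / L] larger components, so the images of their roots cost a factor of at
    most [N^(n/L) <= B^n]. *)

(** * Greedy construction of bounded-degree graphs without short cycles *)

(* [lia] can miss that two displayed occurrences of [#|A|] are the same atom. *)
Ltac card_lia := repeat match goal with
  |- context [card ?A] => let c := fresh "c" in set c := card A; clearbody c end; lia.

Definition simpleb n (g : graph n) : bool :=
  [forall i, forall j, (g (i, j) == g (j, i)) && ~~ g (i, i)].

Lemma simpleP n (g : graph n) : reflect (simple g) (simpleb g).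
Proof.
apply: (iffP forallP) => [H i j|H i].
  by have /forallP/(_ j)/andP[/eqP -> /negbTE ->] := H i.
by apply/forallP => j; have [-> ->] := H i j; rewrite eqxx.
Qed.

Definition nbrs n (g : graph n) (x : 'I_n) := [set y | g (x, y)].

Definition edges n (g : graph n) (S : {set 'I_n}) : {set 'I_n * 'I_n} :=
  [set e | [&& e.1 \in S, e.2 \in S & g e]].

(** [edges] counts ordered pairs, so the bound means at most [#|S| - 1] undirected edges. For a
    simple graph this says that there is no cycle on at most [L] vertices. *)
Definition locally_acyclic L n (g : graph n) : bool :=
  [forall S : {set 'I_n}, (S != set0) && (#|S| <= L) ==> (#|edges g S| + 2 <= 2 * #|S|)].

Lemma locally_acyclicP L n (g : graph n) :
  reflect (forall S : {set 'I_n}, S != set0 -> #|S| <= L -> #|edges g S| + 2 <= 2 * #|S|)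
    (locally_acyclic L g).
Proof.
apply: (iffP forallP) => [H S S0 SL|H S].
  by have /implyP := H S; apply; rewrite S0.
by apply/implyP => /andP[]; exact: H.
Qed.

Definition good d L n (g : graph n) : bool :=
  [&& simpleb g, [forall x, #|nbrs g x| <= d] & locally_acyclic L g].

Definition add_edge n (g : graph n) (x y : 'I_n) : graph n :=
  [ffun e => [|| g e, e == (x, y) | e == (y, x)]].

Fixpoint ball n (g : graph n) (x : 'I_n) (k : nat) : {set 'I_n} :=
  if k is k'.+1 then ball g x k' :|: \bigcup_(z in ball g x k') nbrs g z else [set x].

Lemma ball_center n (g : graph n) x k : x \in ball g x k.
Proof. by elim: k => [|k IH] /=; rewrite ?set11 // inE IH. Qed.

Lemma ballS n (g : graph n) x k : ball g x k \subset ball g x k.+1.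
Proof. exact: subsetUl. Qed.

Lemma ball_sub n (g : graph n) x k l : k <= l -> ball g x k \subset ball g x l.
Proof.
elim: l => [|l IH]; first by rewrite leqn0 => /eqP ->.
rewrite leq_eqVlt => /orP[/eqP -> //|]; rewrite ltnS => /IH H.
exact: subset_trans H (ballS _ _ _).
Qed.

Lemma card_ball d n (g : graph n) x k :
  (forall z, #|nbrs g z| <= d) -> #|ball g x k| <= d.+1 ^ k.
Proof.
move=> Hd; elim: k => [|k IH] /=; first by rewrite cards1.
apply: (leq_trans (leq_card_setU _ _)).
apply: (@leq_trans (#|ball g x k| + #|ball g x k| * d)); last by rewrite expnS; nia.
rewrite leq_add2l -sum_nat_const.
apply: (@leq_trans (\sum_(z in ball g x k) #|nbrs g z|)); last exact: leq_sum.
by apply: (big_ind2 (fun (A : {set 'I_n}) m => #|A| <= m)) => // [|A m B m' HA HB];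
  rewrite ?cards0 // (leq_trans (leq_card_setU _ _)) // leq_add.
Qed.

(** The traces of the balls of radius 0 to [L] on [S] start nonempty and cannot grow [L] times
    within [L] vertices. Where two consecutive traces agree, no edge inside [S] leaves the ball. *)
Lemma ball_cut n (g : graph n) x (S : {set 'I_n}) L :
  #|S| <= L -> x \in S ->
  exists2 k, k < L & forall u v, u \in S -> v \in S -> u \in ball g x k -> g (u, v) ->
    v \in ball g x k.
Proof.
move=> SL xS.
have H k : k < #|S :&: ball g x k| \/
    exists2 k', k' < k & S :&: ball g x k' = S :&: ball g x k'.+1.
  elim: k => [|k [IH|[k' k'k E]]].
  - by left; apply/card_gt0P; exists x; rewrite inE xS ball_center.
  - have sub : S :&: ball g x k \subset S :&: ball g x k.+1 by rewrite setIS ?ballS.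
    have [E|NE] := eqVneq (S :&: ball g x k) (S :&: ball g x k.+1).
      by right; exists k.
    left; apply: leq_ltn_trans IH _; apply: proper_card.
    by rewrite properEneq NE.
  - by right; exists k' => //; apply: ltnW.
have [H'|[k kL E]] := H L.
  by have := leq_trans H' (subset_leq_card (subsetIl _ _)); rewrite ltnNge SL.
exists k => // u v uS vS uB guv.
have : v \in S :&: ball g x k.+1.
  by rewrite inE vS /= inE; apply/orP; right; apply/bigcupP; exists u; rewrite ?inE.
by rewrite -E inE vS.
Qed.

(** Only sets [S] containing both ends matter. A ball around [x] cuts such an [S] into two parts
    with no old edge between them, one containing [x] and the other [y]. The bounds for the parts
    leave room for exactly one more edge. *)
Lemma locally_acyclic_add L n (g : graph n) x y :
  simple g -> locally_acyclic L g -> y \notin ball g x L ->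
  locally_acyclic L (add_edge g x y).
Proof.
move=> sg /locally_acyclicP ag yB; apply/locally_acyclicP => S S0 SL.
have [/andP[xS yS]|NS] := boolP ((x \in S) && (y \in S)); last first.
  suff -> : edges (add_edge g x y) S = edges g S.
    exact: ag.
  apply/setP => -[u v]; rewrite !inE ffunE /=.
  case uS : (u \in S) => //=; case vS : (v \in S) => //=.
  case: eqP => [[ux vy]|_]; first by rewrite -ux -vy uS vS in NS.
  case: eqP => [[ux vy]|_]; first by rewrite -ux -vy uS vS in NS.
  by rewrite !orbF.
have [k kL cut] := ball_cut g SL xS.
have xX : x \in S :&: ball g x k by rewrite inE xS ball_center.
have yY : y \in S :\: ball g x k.
  by rewrite inE yS andbT; apply: contra yB => /(subsetP (ball_sub g x (ltnW kL))).
have cX : #|S :&: ball g x k| <= L.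
  by apply: leq_trans SL; rewrite subset_leq_card ?subsetIl.
have cY : #|S :\: ball g x k| <= L.
  by apply: leq_trans SL; rewrite subset_leq_card ?subsetDl.
have eX : #|edges g (S :&: ball g x k)| + 2 <= 2 * #|S :&: ball g x k|.
  by apply: ag => //; apply/set0Pn; exists x.
have eY : #|edges g (S :\: ball g x k)| + 2 <= 2 * #|S :\: ball g x k|.
  by apply: ag => //; apply/set0Pn; exists y.
have sub : edges (add_edge g x y) S \subset
    edges g (S :&: ball g x k) :|: edges g (S :\: ball g x k) :|: [set (x, y); (y, x)].
  apply/subsetP => -[u v]; rewrite !inE ffunE /= => /and3P[uS vS].
  case/or3P=> [guv|->|->]; rewrite ?orbT //; apply/orP; left.
  rewrite uS vS guv /= !andbT.
  case uB : (u \in ball g x k).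
    by rewrite (cut u v).
  case vB : (v \in ball g x k) => //.
  have [E _] := sg v u.
  by rewrite (cut v u) // E in uB.
have c2 : #|[set (x, y); (y, x)]| <= 2 by rewrite cards2; case: (_ != _).
have := subset_leq_card sub.
have := leq_of_leqif (leq_card_setU (edges g (S :&: ball g x k) :|: edges g (S :\: ball g x k))
   [set (x, y); (y, x)]).
have := leq_of_leqif (leq_card_setU (edges g (S :&: ball g x k)) (edges g (S :\: ball g x k))).
have := cardsID (ball g x k) S.
move: eX eY c2; card_lia.
Qed.

Lemma good_add d L n (g : graph n) x y :
  good d L g -> #|nbrs g x| < d -> #|nbrs g y| < d -> y \notin ball g x L ->
  good d L (add_edge g x y).
Proof.
case/and3P=> /simpleP sg /forallP dg ag dx dy yB.
have xy : x != y by apply: contraNneq yB => <-; exact: ball_center.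
apply/and3P; split; last exact: locally_acyclic_add.
  apply/simpleP => i j; rewrite !ffunE; have [-> ->] := sg i j.
  rewrite !xpair_eqE; split.
    by case: (i == x); case: (j == x); case: (i == y); case: (j == y); case: (g _).
  by have [->|] := eqVneq i x; rewrite ?(negbTE xy) ?andbF.
apply/forallP => z.
have -> : nbrs (add_edge g x y) z =
    nbrs g z :|: (if z == x then [set y] else if z == y then [set x] else set0).
  apply/setP => w; rewrite !inE ffunE !xpair_eqE.
  have [->|zx] := eqVneq z x; first by rewrite (negbTE xy) orbF inE.
  by have [->|zy] := eqVneq z y; rewrite inE.
apply: leq_trans (leq_card_setU _ _) _.
have [->|zx] := eqVneq z x; first by rewrite cards1 addn1.
by have [->|zy] := eqVneq z y; rewrite ?cards1 ?addn1 // cards0 addn0.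
Qed.

(** * Counting good graphs by their number of edges *)

Definition goods d L n j : {set graph n} :=
  [set g | good d L g & #|[set e | g e]| == 2 * j].

Lemma sum_deg n (g : graph n) : \sum_x #|nbrs g x| = #|[set e | g e]|.
Proof.
rewrite -[RHS]sum1_card (eq_bigl (fun e : 'I_n * 'I_n => true && g (e.1, e.2))); last first.
  by case=> a b; rewrite inE.
rewrite -(pair_big_dep xpredT (fun x y => g (x, y)) (fun _ _ => 1)) /=.
by apply: eq_bigr => x _; rewrite sum1_card cardsE.
Qed.

(** At most half of the vertices have degree at least [d], so [F] has at least [n / 2] elements. A
    ball removes at most [n / 4] of them, which leaves at least [n / 2 * n / 4] pairs. *)
Lemma card_addable d L n (g : graph n) j :
  good d L g -> #|[set e | g e]| = 2 * j -> 4 * j <= d * n -> 0 < d -> 4 * d.+1 ^ L <= n ->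
  n ^ 2 <= 8 * #|[set e : 'I_n * 'I_n |
     [&& #|nbrs g e.1| < d, #|nbrs g e.2| < d & e.2 \notin ball g e.1 L]]|.
Proof.
move=> /and3P[_ /forallP dg _] ej jn d0 Ln.
set F := [set x | #|nbrs g x| < d].
have cF : n <= 2 * #|F|.
  have : d * #|~: F| <= 2 * j.
    rewrite -ej -sum_deg mulnC -sum_nat_const.
    rewrite [X in _ <= X](bigID (mem (~: F))) /=.
    apply: leq_trans (leq_addr _ _); apply: leq_sum => x.
    by rewrite !inE -leqNgt.
  have := cardsC F; rewrite card_ord; move: jn d0; clear.
  set a := #|F|; set b := #|~: F|; clearbody a b; nia.
have -> : [set e : 'I_n * 'I_n |
     [&& #|nbrs g e.1| < d, #|nbrs g e.2| < d & e.2 \notin ball g e.1 L]] =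
   [set e | (e.1 \in F) && (e.2 \in F :\: ball g e.1 L)].
  by apply/setP => e; rewrite !inE [_ && (_ < d)]andbC.
have -> : #|[set e : 'I_n * 'I_n | (e.1 \in F) && (e.2 \in F :\: ball g e.1 L)]|
   = \sum_(x in F) #|F :\: ball g x L|.
  rewrite -[LHS]sum1_card (eq_bigl (fun e : 'I_n * 'I_n =>
      (e.1 \in F) && (e.2 \in F :\: ball g e.1 L))).
    rewrite -(pair_big_dep (mem F) (fun x y => y \in F :\: ball g x L) (fun _ _ => 1)) /=.
    by apply: eq_bigr => x _; rewrite sum1_card.
  by case=> a b; rewrite inE.
have H x : x \in F -> n <= 4 * #|F :\: ball g x L|.
  move=> _; have := card_ball x L dg; have := cardsID (ball g x L) F.
  have := subset_leq_card (subsetIr F (ball g x L)).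
  move: Ln cF; clear; card_lia.
have : #|F| * n <= \sum_(x in F) 4 * #|F :\: ball g x L|.
  by rewrite -sum_nat_const; apply: leq_sum.
rewrite -big_distrr /=; move: cF; clear.
set a := #|F|; set b := \sum_(_ in _) _; clearbody a b; rewrite expnS expn1; nia.
Qed.

(** Double counting of pairs (graph, added edge): each graph with [j] edges has at least [n ^ 2 / 8]
    extensions, and each graph with [j.+1] edges arises from at most [2 * j.+1] ordered pairs. *)
Lemma goods_step d L n j :
  4 * j <= d * n -> 0 < d -> 0 < L -> 4 * d.+1 ^ L <= n ->
  #|goods d L n j| * n ^ 2 <= #|goods d L n j.+1| * (16 * j.+1).
Proof.
move=> jn d0 L0 Ln.
pose X (g : graph n) := [set e : 'I_n * 'I_n |
     [&& #|nbrs g e.1| < d, #|nbrs g e.2| < d & e.2 \notin ball g e.1 L]].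
pose P := [set t : graph n * ('I_n * 'I_n) | (t.1 \in goods d L n j) && (t.2 \in X t.1)].
pose Q := [set t : graph n * ('I_n * 'I_n) | (t.1 \in goods d L n j.+1) && t.1 t.2].
pose phi (t : graph n * ('I_n * 'I_n)) := (add_edge t.1 t.2.1 t.2.2, t.2).
have cP : #|goods d L n j| * n ^ 2 <= 8 * #|P|.
  have -> : #|P| = \sum_(g in goods d L n j) #|X g|.
    rewrite -[LHS]sum1_card (eq_bigl (fun t : graph n * ('I_n * 'I_n) =>
      (t.1 \in goods d L n j) && (t.2 \in X t.1))); last by case=> a b; rewrite inE.
    rewrite -(pair_big_dep (mem (goods d L n j)) (fun x y => y \in X x) (fun _ _ => 1)) /=.
    by apply: eq_bigr => g _; rewrite sum1_card.
  rewrite big_distrr /= -sum_nat_const; apply: leq_sum => g; rewrite inE => /andP[gg /eqP ge].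
  exact: card_addable gg ge jn d0 Ln.
have cQ : #|Q| = #|goods d L n j.+1| * (2 * j.+1).
  rewrite -[LHS]sum1_card (eq_bigl (fun t : graph n * ('I_n * 'I_n) =>
      (t.1 \in goods d L n j.+1) && t.1 t.2)); last by case=> a b; rewrite inE.
  rewrite -(pair_big_dep (mem (goods d L n j.+1)) (fun (x : graph n) y => x y) (fun _ _ => 1)) /=.
  rewrite -sum_nat_const; apply: eq_bigr => g; rewrite inE => /andP[_ /eqP <-].
  by rewrite sum1_card cardsE.
(* Since [0 < L], the ball contains all neighbours of [x], so an allowed pair is a genuinely new
   edge. This makes the edge count exact and [phi] injective. *)
have new g x y : (x, y) \in X g -> [/\ x != y, ~~ g (x, y) & good d L g -> ~~ g (y, x)].
  rewrite inE /= => /and3P[_ _ yB].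
  have xy : x != y by apply: contraNneq yB => <-; exact: ball_center.
  have gxy : ~~ g (x, y).
    apply: contra yB => gxy; apply: (subsetP (ball_sub g x L0)).
    by rewrite /= big_set1 !inE gxy orbT.
  by split=> // /and3P[/simpleP sg _ _]; have [-> _] := sg y x.
have imP : phi @: P \subset Q.
  apply/subsetP => _ /imsetP[[g [x y]] gP ->].
  move: gP; rewrite 2!inE /= => /andP[/andP[gg /eqP ge] xyX].
  have [xy gxy gyx] := new _ _ _ xyX.
  move: xyX; rewrite inE /= => /and3P[dx dy yB].
  rewrite 2!inE /= ffunE eqxx orbT andbT good_add //=.
  have -> : [set e | add_edge g x y e] = (x, y) |: ((y, x) |: [set e | g e]).
    by apply/setP => e; rewrite !inE ffunE; case: (g e); case: (e == _); case: (e == _).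
  rewrite !cardsU1 !inE xpair_eqE negb_or (negbTE xy) /= gxy gyx // ge.
  by rewrite mulnS addnA.
have injP : {in P &, injective phi}.
  move=> [g [x y]] [g' [x' y']]; rewrite 2!inE /= => /andP[/andP[gg _] xyX].
  rewrite 2!inE /= => /andP[/andP[gg' _] xyX'] [E Ex Ey]; subst x' y'.
  have [xy gxy gyx] := new _ _ _ xyX; have [_ gxy' gyx'] := new _ _ _ xyX'.
  congr pair; apply/ffunP => e; move/ffunP/(_ e): E; rewrite !ffunE.
  have [->|_] := eqVneq e (x, y); first by rewrite (negbTE gxy) (negbTE gxy').
  have [->|_] := eqVneq e (y, x); first by rewrite (negbTE (gyx gg)) (negbTE (gyx' gg')).
  by rewrite !orbF.
have := subset_leq_card imP; rewrite card_in_imset // cQ; move: cP; clear.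
set a := #|_|; set b := #|_|; set c := #|_|; clearbody a b c.
set e := a * _; clearbody e; nia.
Qed.

(** Iterates [goods_step] from the empty graph, with each factor [16 * i] bounded by [16 * j]. *)
Lemma card_goods d L n j :
  4 * j <= d * n -> 0 < d -> 0 < L -> 4 * d.+1 ^ L <= n ->
  n ^ (2 * j) <= #|goods d L n j| * (16 * j) ^ j.
Proof.
move=> jn d0 L0 Ln.
suff H i : i <= j -> n ^ (2 * i) <= #|goods d L n i| * (16 * j) ^ i by exact: H.
elim: i => [_|i IH ij].
  rewrite muln1; apply/card_gt0P; exists [ffun=> false].
  rewrite !inE; apply/andP; split; last first.
    by rewrite cards_eq0; apply/eqP/setP => e; rewrite !inE ffunE.
  apply/and3P; split.
  - by apply/simpleP => x y; rewrite !ffunE.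
  - apply/forallP => x; rewrite (_ : nbrs _ x = set0) ?cards0 //.
    by apply/setP => e; rewrite !inE ffunE.
  - apply/locally_acyclicP => S S0 _; rewrite (_ : edges _ S = set0) ?cards0.
      by rewrite -card_gt0 in S0; lia.
    by apply/setP => e; rewrite !inE ffunE !andbF.
rewrite mulnS expnD mulnC [(16 * j) ^ _]expnS.
apply: (@leq_trans (#|goods d L n i| * (16 * j) ^ i * n ^ 2)).
  by rewrite leq_mul2r IH ?orbT // ltnW.
rewrite (mulnAC #|_|) [X in _ <= X]mulnA leq_mul2r; apply/orP; right.
apply: leq_trans (goods_step (d := d) (L := L) (n := n) (j := i) _ d0 L0 Ln) _; first by lia.
by rewrite leq_mul2l leq_mul2l ij orbT orbT.
Qed.

(** * Breadth-first orderings *)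

(** [p] gives parents, and its fixed points are the roots. By the last clause no edge joins a vertex
    before a root to that root or a later vertex, so components are intervals starting at their
    roots. *)
Definition bfs_ordered n (h : graph n) (p : 'I_n -> 'I_n) : Prop :=
  [/\ forall i, p i <= i,
      forall i j : 'I_n, i <= j -> p i <= p j,
      forall i, p i != i -> h (p i, i)
    & forall r i j : 'I_n, p r = r -> i < r -> r <= j -> ~~ h (i, j)].

(* A partial breadth-first search: [vs] lists the visited vertices, [ps] the positions of their
   parents (a root is its own parent), and all neighbours of the first [q] vertices are visited. *)
Definition bfs_state n (g : graph n.+1) (vs : seq 'I_n.+1) (ps : seq nat) q : Prop :=
  [/\ uniq vs /\ size ps = size vs,
      q <= size vs,
      sorted leq ps /\ all (leq^~ q) ps,
      forall i, i < size vs ->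
        [/\ nth 0 ps i <= i,
            nth 0 ps i < i -> g (nth ord0 vs (nth 0 ps i), nth ord0 vs i)
          & nth 0 ps i = i -> forall a v, a < i -> v \notin take i vs -> ~~ g (nth ord0 vs a, v)]
    & forall a v, a < q -> v \notin vs -> ~~ g (nth ord0 vs a, v)].

(** Covers both ways to visit a vertex: for [q < size vs] it becomes a child of the vertex at
    position [q]; for [q = size vs] the parent [q] is its own position, so it is a root. *)
Lemma bfs_state_visit n (g : graph n.+1) vs ps q v :
  bfs_state g vs ps q -> v \notin vs -> (q < size vs -> g (nth ord0 vs q, v)) ->
  bfs_state g (rcons vs v) (rcons ps q) q.
Proof.
case=> -[uvs sps] qs [sorted_ps psq] H fr vvs gv.
have tk i : i <= size vs -> take i (rcons vs v) = take i vs.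
  by move=> il; rewrite -cats1 takel_cat.
split.
- by rewrite rcons_uniq vvs uvs !size_rcons sps.
- by rewrite size_rcons ltnW.
- move: sorted_ps; rewrite !(sorted_pairwise leq_trans) pairwise_rcons => ->.
  by rewrite psq all_rcons leqnn psq.
- move=> i; rewrite size_rcons ltnS leq_eqVlt => /orP[/eqP ->|il].
    rewrite !nth_rcons sps ltnn eqxx; split=> //.
      by move=> ql; rewrite ql gv.
    by move=> E a w al; rewrite tk // take_size nth_rcons al; apply: fr; rewrite E.
  rewrite !nth_rcons sps il; have [H1 H2 H3] := H i il; split=> //.
    by move=> pl; rewrite (ltn_trans pl il); exact: H2.
  by move=> E a w ai; rewrite tk ?(ltnW il) // nth_rcons (ltn_trans ai il); exact: H3.
- move=> a w aq; rewrite mem_rcons inE negb_or => /andP[_ wvs].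
  by rewrite nth_rcons (leq_trans aq qs); exact: fr.
Qed.

Lemma bfs_state_advance n (g : graph n.+1) vs ps q :
  bfs_state g vs ps q -> q < size vs -> (forall v, v \notin vs -> ~~ g (nth ord0 vs q, v)) ->
  bfs_state g vs ps q.+1.
Proof.
case=> Hu _ [sps psq] H fr ql nv; split=> //.
- by split=> //; apply: sub_all psq => x /leqW.
- move=> a v; rewrite ltnS leq_eqVlt => /orP[/eqP -> |]; [exact: nv|exact: fr].
Qed.

Lemma size_uniq_ord n (s : seq 'I_n) : uniq s -> size s <= n.
Proof. by move/card_uniqP <-; rewrite -[X in _ <= X]card_ord max_card. Qed.

(** [m] is fuel: every move increases [size vs + q], and both summands stay at most [n.+1]. *)
Lemma bfs_state_complete n (g : graph n.+1) m vs ps q :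
  bfs_state g vs ps q -> 2 * n.+1 <= size vs + q + m ->
  exists vs' ps' q', bfs_state g vs' ps' q' /\ size vs' = n.+1.
Proof.
elim: m vs ps q => [|m IH] vs ps q st; have [[uvs sps] qs _ _ _] := st.
  have sn := size_uniq_ord uvs.
  by move=> H; exists vs, ps, q; split=> //; lia.
have sn := size_uniq_ord uvs.
move=> H; have [E|NE] := eqVneq (size vs) n.+1; first by exists vs, ps, q.
have [ql|ql] := ltnP q (size vs).
  case: (pickP [pred v | (v \notin vs) && g (nth ord0 vs q, v)]) => [v /andP[vvs gv]|nv].
    apply: (IH (rcons vs v) (rcons ps q) q); last by rewrite size_rcons; lia.
    exact: bfs_state_visit.
  apply: (IH vs ps q.+1); last by lia.
  by apply: bfs_state_advance => // v vvs; have /= := nv v; rewrite vvs /= => ->.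
(* Here [q = size vs]: the queue is exhausted, so an unvisited vertex starts a new component. *)
case: (pickP [pred v | v \notin vs]) => [v vvs|nv].
  apply: (IH (rcons vs v) (rcons ps q) q); last by rewrite size_rcons; lia.
  by apply: bfs_state_visit => //; rewrite ltnNge ql.
have : n.+1 <= size vs.
  rewrite -[X in X <= _]card_ord cardE; apply: uniq_leq_size; first exact: enum_uniq.
  by move=> v _; have /= /negbFE := nv v.
by move=> H'; case/negP: NE; rewrite eqn_leq sn.
Qed.

Lemma bfs_exists n (g : graph n) :
  exists (s : {perm 'I_n}) (p : 'I_n -> 'I_n), bfs_ordered (pullback s g) p.
Proof.
case: n g => [|n] g; first by exists 1%g, (fun i => i); split; case.
have [|vs [ps [q [[[uvs sps] _ [sorted_ps _] H _] sz]]]] :=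
  @bfs_state_complete n g (2 * n.+1) [::] [::] 0 _ (leq_addl _ _).
  by split.
have inj : injective (fun i : 'I_n.+1 => nth ord0 vs i).
  move=> i j /eqP; rewrite nth_uniq ?sz // => /eqP; exact: val_inj.
have szi (i : 'I_n.+1) : i < size vs by rewrite sz.
pose p (i : 'I_n.+1) : 'I_n.+1 := inord (nth 0 ps i).
have pE (i : 'I_n.+1) : p i = nth 0 ps i :> nat.
  by have [le _ _] := H i (szi i); rewrite inordK // (leq_ltn_trans le).
exists (perm inj), p; split.
- by move=> i; rewrite pE; have [] := H i (szi i).
- move=> i j ij; rewrite !pE; apply: sorted_leq_nth => //; rewrite ?inE ?sps //.
  exact: leq_trans.
- move=> i pi; rewrite ffunE /= !permE pE.
  by have [le + _] := H i (szi i); apply; rewrite ltn_neqAle le andbT -pE.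
- move=> r i j pr ir rj; rewrite ffunE /= !permE.
  have [_ _ +] := H r (szi r); apply=> //; first by rewrite -pE pr.
  apply/negP => /(nthP ord0)[k]; rewrite size_take szi => kr; rewrite nth_take //.
  move/eqP; rewrite nth_uniq ?sz //; last by rewrite (ltn_trans kr).
  by move/eqP => E; move: rj; rewrite -E leqNgt kr.
Qed.

(** * Components in a breadth-first ordering *)

(** The interval from [r] up to the next fixed point of [p]. For a root of a breadth-first ordering
    it is the connected component of [r]. *)
Definition component n (p : 'I_n -> 'I_n) (r : 'I_n) : {set 'I_n} :=
  [set j : 'I_n | (r <= j) && [forall k : 'I_n, (r < k <= j) ==> (p k != k)]].

Lemma compP n (p : 'I_n -> 'I_n) (r j : 'I_n) :
  reflect (r <= j /\ forall k : 'I_n, r < k -> k <= j -> p k != k) (j \in component p r).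
Proof.
rewrite inE; apply: (iffP andP) => -[rj H]; split=> //.
  by move=> k rk kj; have /forallP/(_ k) := H; rewrite rk kj.
by apply/forallP => k; apply/implyP => /andP[]; exact: H.
Qed.

Lemma comp_root n (p : 'I_n -> 'I_n) r : r \in component p r.
Proof. by apply/compP; split=> // k rk; rewrite leqNgt rk. Qed.

Lemma card_ord_interval n (A : {set 'I_n}) a b :
  (forall j : 'I_n, j \in A -> a <= j < b) -> #|A| <= b - a.
Proof.
move=> H; rewrite cardE -(size_map val) -(size_iota a (b - a)); apply: uniq_leq_size.
  by rewrite map_inj_uniq ?enum_uniq //; exact: val_inj.
move=> _ /mapP[j + ->]; rewrite mem_enum => /H; rewrite mem_iota /=; lia.
Qed.

Lemma ltn_div_add L a b : 0 < L -> a + L <= b -> a %/ L < b %/ L.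
Proof. by move=> L0 /(leq_div2r L); rewrite divnDr // divnn L0 addn1. Qed.

Lemma comp_index_ltn L n (p : 'I_n -> 'I_n) (r : 'I_n) :
  0 < L -> L <= #|component p r| -> r %/ L < n %/ L.
Proof.
move=> L0 big; apply: ltn_div_add => //.
have : #|component p r| <= n - r.
  by apply: card_ord_interval => j /compP[-> _] /=.
have := ltn_ord r; move: big; clear; card_lia.
Qed.

(** A component with at least [L] vertices fills the positions between its root and the next root,
    so roots of such components are at least [L] apart and lie in different slots of width [L]. *)
Lemma comp_index_inj L n (p : 'I_n -> 'I_n) (r r' : 'I_n) :
  0 < L -> p r = r -> p r' = r' -> L <= #|component p r| -> L <= #|component p r'| ->
  r %/ L = r' %/ L -> r = r'.
Proof.
move=> L0; wlog rr' : r r' / r <= r'.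
  move=> H; case/orP: (leq_total r r') => [|rr' pr pr' b b' E]; first exact: H.
  by symmetry; apply: H.
move=> pr pr' big _ E; apply/eqP; apply: contraTT (leqnn (r %/ L)) => ne.
rewrite -ltnNge [X in _ < X]E; apply: ltn_div_add => //.
have lt : r < r' by rewrite ltn_neqAle rr' andbT.
have : #|component p r| <= r' - r.
  apply: card_ord_interval => j /compP[-> H] /=; rewrite ltnNge; apply/negP => r'j.
  by have := H r' lt r'j; rewrite pr' eqxx.
move: big lt; clear; card_lia.
Qed.

Section BfsOrdered.

Variables (n : nat) (h : graph n) (p : 'I_n -> 'I_n).
Hypotheses (sh : simple h) (hp : bfs_ordered h p).

Lemma comp_parent r i : p r = r -> i \in component p r -> p i \in component p r.
Proof.
case: hp => le mono _ _ pr /compP[ri H]; apply/compP; split.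
  by rewrite -pr mono.
by move=> k rk ki; apply: H => //; apply: leq_trans ki (le i).
Qed.

Lemma comp_child r i : p i \in component p r -> i \in component p r.
Proof.
case: hp => le mono _ _ /compP[ri H]; apply/compP; split; first exact: leq_trans ri (le i).
move=> k rk ki; have [kpi|kpi] := leqP k (p i); first exact: H.
by apply: contraTneq kpi => E; rewrite -leqNgt -E mono.
Qed.

Lemma comp_exists i : exists2 r, p r = r & i \in component p r.
Proof.
case: hp => le _ _ _; have [m] := ubnP (i : nat); elim: m i => // m IH i im.
have [pi|pi] := eqVneq (p i) i; first by exists i => //; exact: comp_root.
have [|r pr ir] := IH (p i).
  by apply: leq_trans (im : i <= m); rewrite ltn_neqAle le andbT.
by exists r => //; exact: comp_child.
Qed.

Lemma comp_edge r (i j : 'I_n) : p r = r -> i \in component p r -> h (i, j) -> j \in component p r.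
Proof.
case: hp => _ _ _ cut pr /compP[ri H] hij; apply/compP.
have rj : r <= j.
  rewrite leqNgt; apply/negP => jr.
  by have [E _] := sh i j; have := cut r j i pr jr ri; rewrite -E hij.
split=> // k rk kj; have [ki|ik] := leqP k i; first exact: H.
by apply/eqP => pk; have := cut k i j pk ik kj; rewrite hij.
Qed.

(** The parent edges in both orientations, [U] and [D], already give [2 * (#|component p r| - 1)]
    ordered pairs, the maximum that local acyclicity allows. Hence there are no other edges. *)
Lemma comp_tree L r (i j : 'I_n) :
  locally_acyclic L h -> p r = r -> #|component p r| <= L -> i \in component p r -> h (i, j) ->
  p i = j \/ p j = i.
Proof.
move=> /locally_acyclicP acyc pr small ir hij.
case: hp => le mono edge _.
have r0 : component p r != set0 by apply/set0Pn; exists r; exact: comp_root.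
have le2 := acyc _ r0 small.
pose T := component p r :\ r.
pose U := [set (k, p k) | k in T]; pose D := [set (p k, k) | k in T].
have notroot k : k \in T -> p k < k.
  rewrite 2!inE => /andP[kr /compP[rk H]]; rewrite ltn_neqAle le andbT.
  by apply: H => //; rewrite ltn_neqAle rk andbT eq_sym.
have cT : #|component p r| = #|T|.+1 by rewrite (cardsD1 r) comp_root.
have cU : #|U| = #|T| by rewrite card_imset // => a b [].
have cD : #|D| = #|T| by rewrite card_imset // => a b [].
have UD : [disjoint U & D].
  rewrite -setI_eq0; apply/eqP/setP => -[a b]; rewrite !inE; apply/negP => /andP[].
  case/imsetP=> k kT [-> ->] /imsetP[l lT [E F]].
  by have := notroot _ kT; have := notroot _ lT; rewrite -E F; lia.
have sub : U :|: D \subset edges h (component p r).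
  have memE k : k \in T -> [/\ k \in component p r, p k \in component p r & h (p k, k)].
    move=> kT; have kr : k \in component p r by move: kT; rewrite inE => /andP[].
    split=> //; first exact: comp_parent.
    by apply: edge; apply: contraTneq (notroot _ kT) => ->; rewrite ltnn.
  rewrite subUset; apply/andP; split; apply/subsetP => _ /imsetP[k /memE[kr pkr hk] ->];
    rewrite inE /= kr pkr //=.
  by have [-> _] := sh k (p k).
have : (i, j) \in U :|: D.
  suff -> : U :|: D = edges h (component p r) by rewrite inE /= ir hij (comp_edge pr ir hij).
  apply/eqP; rewrite eqEcard sub /= cardsU disjoint_setI0 // cards0 subn0 cU cD.
  move: le2 cT; clear; card_lia.
by rewrite inE => /orP[] /imsetP[k _ [-> ->]]; [left|right].
Qed.

(** Recovers [h] on a small component from [p] alone; the condition [i != j] excludes the loop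
    suggested by a root being its own parent. *)
Lemma comp_treeE L r (i j : 'I_n) :
  locally_acyclic L h -> p r = r -> #|component p r| <= L -> i \in component p r ->
  h (i, j) = (i != j) && ((p i == j) || (p j == i)).
Proof.
move=> acyc pr small ir; case: hp => _ _ edge _; apply/idP/idP.
  move=> hij; apply/andP; split.
    by apply: contraTneq hij => ->; have [_ ->] := sh j j.
  by case: (comp_tree acyc pr small ir hij) => ->; rewrite eqxx ?orbT.
case/andP=> ij /orP[] /eqP E.
  by have [-> _] := sh i j; rewrite -E edge // E eq_sym.
by rewrite -{1}E edge // E.
Qed.

End BfsOrdered.

(** * Encoding subgraphs of a host *)

(** Codes are given by a relation, so no decoder has to be defined: it is enough that codes exist
    and determine the object. *)
Lemma card_le_encoding (T U : finType) (E : T -> U -> Prop) (Q : {set U}) :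
  (forall u, u \in Q -> exists t, E t u) -> (forall t u u', E t u -> E t u' -> u = u') ->
  #|Q| <= #|T|.
Proof.
move=> ex inj.
(* [None] is the value outside [Q], where [T] might offer no element. *)
have /fin_all_exists[f fP] : forall u, exists t : option T,
    u \in Q -> exists2 t', t = Some t' & E t' u.
  move=> u; case uQ : (u \in Q); last by exists None.
  by have [t Et] := ex u uQ; exists (Some t) => _; exists t.
have -> : #|Q| = #|f @: Q|.
  rewrite card_in_imset // => u v uQ vQ fuv.
  have [t ft Et] := fP u uQ; have [t' ft' Et'] := fP v vQ.
  by move: fuv Et'; rewrite ft ft' => -[<-]; exact: inj.
have -> : #|T| = #|Some @: [set: T]| by rewrite card_imset ?cardsT // => a b [].
apply: subset_leq_card; apply/subsetP => _ /imsetP[u uQ ->].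
by have [t -> _] := fP u uQ; exact: imset_f.
Qed.

Lemma card_set_ord m : #|{set 'I_m}| = 2 ^ m.
Proof.
rewrite -[X in 2 ^ X]card_ord -[#|'I_m|]cardsT -card_powerset; apply: eq_card => x.
by rewrite !inE subsetT.
Qed.

Definition parent_code n (p : 'I_n -> 'I_n) : {set 'I_(n + n)} :=
  [set k : 'I_(n + n) | [exists i : 'I_n, k == i + p i :> nat]].

(* A monotone [p] makes [i + p i] strictly increasing, so its set of values determines [p]. *)
Lemma parent_code_inj n (h h' : graph n) p p' :
  bfs_ordered h p -> bfs_ordered h' p' -> parent_code p = parent_code p' -> p =1 p'.
Proof.
move=> [_ mono _ _] [_ mono' _ _] E.
pose q (p : 'I_n -> 'I_n) (i : 'I_n) : nat := i + p i.
have srt (p0 : 'I_n -> 'I_n) : (forall i j : 'I_n, i <= j -> p0 i <= p0 j) ->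
    sorted ltn (map (q p0) (enum 'I_n)).
  move=> m; apply: (homo_sorted (e := fun i j : 'I_n => i < j)).
    by move=> i j ij; rewrite /q /= -addSn leq_add // m // ltnW.
  by have := iota_ltn_sorted 0 n; rewrite -val_enum_ord sorted_map.
have mem (p0 : 'I_n -> 'I_n) k : (k \in map (q p0) (enum 'I_n)) =
    [exists k' : 'I_(n + n), (k' \in parent_code p0) && (k' == k :> nat)].
  apply/mapP/existsP => [[i _ ->]|[k' /andP[]]].
    have lt : q p0 i < n + n by have := ltn_ord i; have := ltn_ord (p0 i); rewrite /q; lia.
    by exists (Ordinal lt); rewrite inE eqxx andbT; apply/existsP; exists i.
  by rewrite inE => /existsP[i /eqP -> /eqP <-]; exists i; rewrite ?mem_enum.
have : map (q p) (enum 'I_n) = map (q p') (enum 'I_n).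
  apply: (irr_sorted_eq ltn_trans ltnn); [exact: srt|exact: srt|].
  by move=> k; rewrite !mem E.
by move/eq_in_map => H i; apply: val_inj; have /addnI := H i (mem_enum 'I_n i).
Qed.

Lemma locally_acyclic_embed L m n (h : graph m) (g : graph n) (f : 'I_m -> 'I_n) :
  injective f -> (forall i j, h (i, j) -> g (f i, f j)) ->
  locally_acyclic L g -> locally_acyclic L h.
Proof.
move=> inj hg /locally_acyclicP acyc; apply/locally_acyclicP => S S0 SL.
have cS : #|f @: S| = #|S| by rewrite card_imset.
have f0 : f @: S != set0 by rewrite -card_gt0 cS card_gt0.
have := acyc (f @: S) f0; rewrite cS => /(_ SL); apply: leq_trans; rewrite leq_add2r.
have <- : #|[set (f e.1, f e.2) | e in edges h S]| = #|edges h S|.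
  by rewrite card_imset // => -[a b] [c d] [/inj -> /inj ->].
apply: subset_leq_card; apply/subsetP => _ /imsetP[[i j] + ->]; rewrite inE /= => /and3P[iS jS hij].
by rewrite inE /= !imset_f //= hg.
Qed.

(** No component exceeds [n] vertices, so all are trees and the parent code alone determines the
    graph. *)
Lemma card_bfs_forests n (Q : {set graph n}) :
  (forall h, h \in Q -> [/\ simple h, locally_acyclic n h & exists p, bfs_ordered h p]) ->
  #|Q| <= 2 ^ (n + n).
Proof.
move=> HQ; rewrite -card_set_ord.
pose E (P : {set 'I_(n + n)}) (h : graph n) :=
  [/\ simple h, locally_acyclic n h & exists2 p, bfs_ordered h p & P = parent_code p].
apply: (card_le_encoding (E := E)) => [h /HQ[sh ah [p hp]]|P h h'].
  by exists (parent_code p); split=> //; exists p.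
move=> [sh ah [p hp ->]] [sh' ah' [p' hp' /(parent_code_inj hp hp') pp']].
apply/ffunP => -[i j].
have small r (p0 : 'I_n -> 'I_n) : #|component p0 r| <= n.
  by rewrite -[X in _ <= X](card_ord n) max_card.
have [r pr ir] := comp_exists hp i; have [r' pr' ir'] := comp_exists hp' i.
rewrite (comp_treeE sh hp j ah pr (small _ _) ir).
by rewrite (comp_treeE sh' hp' j ah' pr' (small _ _) ir') !pp'.
Qed.

Definition nbr n (g : graph n) (x : 'I_n) (k : nat) : 'I_n := nth x (enum (nbrs g x)) k.

Lemma nbr_surj d n (g : graph n) x y :
  #|nbrs g x| <= d -> g (x, y) -> exists k : 'I_d, y = nbr g x k.
Proof.
move=> dx gxy; have yN : y \in enum (nbrs g x) by rewrite mem_enum inE.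
have lt : index y (enum (nbrs g x)) < d by rewrite (leq_trans _ dx) // cardE index_mem.
by exists (Ordinal lt); rewrite /nbr nth_index.
Qed.

(* A code of [h] inside the host [g], relative to an embedding [f]: the search tree, for each
   non-root the index of its image among the neighbours of the image of its parent, for each
   vertex the indices of its neighbours, and the images of the roots of the components with at
   least [L] vertices, stored in slots of width [L]. *)
Definition encodes d L N (g : graph N) n
    (t : {set 'I_(n + n)} * {ffun 'I_n -> 'I_d} * {ffun 'I_n -> {set 'I_d}}
         * {ffun 'I_(n %/ L) -> 'I_N}) (h : graph n) : Prop :=
  let: (P, lab, adj, addr) := t in
  exists p f,
  [/\ [/\ simple h, bfs_ordered h p & P = parent_code p],
      injective f /\ forall i j, h (i, j) -> g (f i, f j),
      forall i, p i != i -> f i = nbr g (f (p i)) (lab i),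
      forall i k, (k \in adj i) = [exists j, h (i, j) && (f j == nbr g (f i) k)]
    & forall (r : 'I_n) (q : 'I_(n %/ L)),
        p r = r -> L <= #|component p r| -> q = r %/ L :> nat -> f r = addr q].

Lemma encodes_exists d L N (g : graph N) n (h : graph n) p f :
  0 < d -> 0 < L -> (forall x, #|nbrs g x| <= d) ->
  simple h -> bfs_ordered h p -> injective f -> (forall i j, h (i, j) -> g (f i, f j)) ->
  exists t, encodes (d := d) (L := L) g t h.
Proof.
move=> d0 L0 dg sh hp inj hg.
have /fin_all_exists[lab labP] : forall i, exists k : 'I_d, p i != i -> f i = nbr g (f (p i)) k.
  move=> i; have [E|ne] := eqVneq (p i) i; first by exists (Ordinal d0).
  have [_ _ edge _] := hp.
  by have [k ->] := nbr_surj (dg _) (hg _ _ (edge i ne)); exists k.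
have /fin_all_exists[addr addrP] : forall q : 'I_(n %/ L), exists v, forall r : 'I_n,
    p r = r -> L <= #|component p r| -> q = r %/ L :> nat -> f r = v.
  move=> q.
  (* By [comp_index_inj] a slot holds at most one root of a large component; an empty slot receives
     an arbitrary vertex. *)
  case: (pickP [pred r : 'I_n | [&& p r == r, L <= #|component p r| & q == r %/ L :> nat]]).
    move=> r /and3P[/eqP pr big /eqP qr]; exists (f r) => r' pr' big' qr'; congr f.
    by apply: (comp_index_inj L0 pr' pr big' big); rewrite -qr -qr'.
  have n0 : 0 < n by apply: leq_trans (leq_div n L); apply: leq_ltn_trans (ltn_ord q).
  move=> none; exists (f (Ordinal n0)) => r pr big qr.
  by have := none r; rewrite /= pr big qr !eqxx.
exists (parent_code p, [ffun i => lab i],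
  [ffun i => [set k : 'I_d | [exists j, h (i, j) && (f j == nbr g (f i) k)]]], [ffun q => addr q]).
exists p, f; split=> //.
- by move=> i; rewrite ffunE; exact: labP.
- by move=> i k; rewrite ffunE inE.
- by move=> r q; rewrite ffunE; exact: addrP.
Qed.

(** The embeddings need to agree only on large components: there the root address and the labels fix
    them, and then the sets [adj] fix the edges. Small components are trees given by the parent
    code. *)
Lemma encodes_inj d L N (g : graph N) n t (h h' : graph n) :
  0 < L -> (forall x, #|nbrs g x| <= d) -> locally_acyclic L g ->
  encodes (d := d) (L := L) g t h -> encodes (d := d) (L := L) g t h' -> h = h'.
Proof.
move=> L0 dg acyc; case: t => [[[P lab] adj] addr].
case=> [p [f [[sh hp ->] [inj hg] labP adjP addrP]]].
case=> [p' [f' [[sh' hp' /(parent_code_inj hp hp') pp'] [inj' hg'] labP' adjP' addrP']]].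
have ah := locally_acyclic_embed inj hg acyc.
have ah' := locally_acyclic_embed inj' hg' acyc.
have cc r : component p r = component p' r.
  by apply/setP => j; apply/compP/compP => -[rj H]; split=> // k rk kj;
    [rewrite -pp'|rewrite pp']; exact: H.
have ff r i : p r = r -> L <= #|component p r| -> i \in component p r -> f i = f' i.
  move=> pr big; have [m] := ubnP (i : nat); elim: m i => // m IH i im ir.
  have [E|ne] := eqVneq (p i) i.
    have -> : i = r.
      case/compP: ir => ri H; apply/eqP; apply: contraT => ir.
      have lt : r < i by rewrite ltn_neqAle ri andbT eq_sym.
      by have := H i lt (leqnn i); rewrite E eqxx.
    pose q := Ordinal (comp_index_ltn L0 big).
    by rewrite (addrP r q) // (addrP' r q) -?pp' -?cc.
  rewrite labP // labP' -?pp' // IH //; last exact: comp_parent hp _ _ pr ir.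
  have [le _ _ _] := hp.
  by apply: leq_trans (im : i <= m); rewrite ltn_neqAle le andbT.
(* An index in [adj i] names a vertex of the host, and injectivity of [f2] makes its preimage
   unique. *)
have sub (h1 h2 : graph n) (f1 f2 : 'I_n -> 'I_N) (i j : 'I_n) :
    (forall i j, h1 (i, j) -> g (f1 i, f1 j)) -> injective f2 ->
    (forall i k, (k \in adj i) = [exists j, h1 (i, j) && (f1 j == nbr g (f1 i) k)]) ->
    (forall i k, (k \in adj i) = [exists j, h2 (i, j) && (f2 j == nbr g (f2 i) k)]) ->
    f1 i = f2 i -> f1 j = f2 j -> h1 (i, j) -> h2 (i, j).
  move=> hg1 inj2 adj1 adj2 fi fj hij.
  have [k fk] := nbr_surj (dg _) (hg1 _ _ hij).
  have : k \in adj i by rewrite adj1; apply/existsP; exists j; rewrite hij fk eqxx.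
  rewrite adj2 => /existsP[j' /andP[h2ij' /eqP E]].
  by rewrite (_ : j = j') //; apply: inj2; rewrite E -fi -fk.
apply/ffunP => -[i j].
have [r pr ir] := comp_exists hp i.
have pr' : p' r = r by rewrite -pp'.
have ir' : i \in component p' r by rewrite -cc.
have [big|small] := leqP L #|component p r|.
  apply/idP/idP => hij.
    apply: (sub h h' f f' i j hg inj' adjP adjP' _ _ hij); apply: (ff r) => //.
    exact (comp_edge sh hp pr ir hij).
  apply: (sub h' h f' f i j hg' inj adjP' adjP _ _ hij); symmetry; apply: (ff r) => //; rewrite cc.
  exact (comp_edge sh' hp' pr' ir' hij).
rewrite (comp_treeE sh hp j ah pr (ltnW small) ir).
rewrite (comp_treeE sh' hp' j ah' pr' _ ir') ?pp' // -cc; exact: ltnW.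
Qed.

Lemma card_bfs_subgraphs d L N (g : graph N) n (Q : {set graph n}) :
  0 < d -> 0 < L -> good d L g ->
  (forall h, h \in Q -> [/\ simple h, exists p, bfs_ordered h p
     & exists2 f, injective f & forall i j, h (i, j) -> g (f i, f j)]) ->
  #|Q| <= 2 ^ (n + n) * d ^ n * (2 ^ d) ^ n * N ^ (n %/ L).
Proof.
move=> d0 L0 /and3P[_ /forallP dg acyc] HQ.
apply: leq_trans (card_le_encoding (E := @encodes d L N g n) _ _) _.
- move=> h /HQ[sh [p hp] [f inj hg]]; exact: encodes_exists hp inj hg.
- by move=> t h h'; exact: encodes_inj.
by rewrite !card_prod !card_ffun !card_set_ord !card_ord.
Qed.

(** * The class of subgraphs of the hosts *)

Lemma INR_expn m n : INR (m ^ n) = (INR m ^ n)%R.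
Proof. by elim: n => // n IH; rewrite expnS mult_INR IH. Qed.

Lemma c_factorial_labeled_count c k C n :
  c_factorial c C -> (c <= INR k)%R -> 0 < n -> labeled_count C n <= n ^ (k * n).
Proof.
move=> [_ /(_ n) H] ck n0; apply/leP; apply: INR_le; apply: Rle_trans H _.
have n1 : (1 <= INR n)%R by apply: (le_INR 1); apply/leP.
have n0' : (0 < INR n)%R by lra.
rewrite INR_expn -Rpower_pow // mult_INR.
by apply: Rle_Rpower => //; apply: Rmult_le_compat_r => //; lra.
Qed.

(** With [K * N] edges there are at least [(N ^ K / (16 * K) ^ K) ^ N] good graphs. As [K = k.+1]
    and [(16 * K) ^ K < N], this exceeds [N ^ (k * N)], the most that the class can hold. *)
Lemma exists_good_notin (c : R) :
  exists d B, [/\ 0 < d, 1 < B & forall L C, 0 < L -> c_factorial c C ->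
    exists g : graph (B ^ L), good d L g && ~~ C _ g].
Proof.
have [k ck] : exists k, (c <= INR k)%R.
  by have [k H] := INR_archimed 1 c Rlt_0_1; exists k; lra.
(* [d] lets [card_goods] reach [K * N] edges. The first summand of [B] makes [B ^ L] large against
   the balls, the second makes it exceed [(16 * K) ^ K]. *)
pose K := k.+1; pose d := 4 * K; pose B := 4 * d.+1 + (16 * K) ^ K.
have B1 : 1 < B by rewrite /B; lia.
exists d, B; split=> // L C L0 HC; set N := B ^ L.
have BN : B <= N by rewrite -[X in X <= _]expn1 leq_pexp2l // ltnW.
have N0 : 0 < N by rewrite expn_gt0 ltnW.
have KN : (16 * K) ^ K < N by apply: leq_trans BN; rewrite /B; lia.
have LN : 4 * d.+1 ^ L <= N.
  apply: (@leq_trans ((4 * d.+1) ^ L)); last by rewrite leq_exp2r // /B leq_addr.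
  by rewrite expnMn leq_mul2r -{1}[4]expn1 leq_pexp2l ?orbT.
have cg : N ^ (K * N) <= #|goods d L N (K * N)| * ((16 * K) ^ K) ^ N.
  rewrite -(@leq_pmul2r (N ^ (K * N))) ?expn_gt0 ?N0 // -expnD addnn -mul2n.
  rewrite -expnM -mulnA -expnMn -(mulnA 16).
  by apply: card_goods; rewrite ?mulnA.
case: (pickP (fun g : graph N => good d L g && ~~ C N g)) => [g Hg|none]; first by exists g.
have : #|goods d L N (K * N)| <= N ^ (k * N).
  apply: leq_trans (c_factorial_labeled_count HC ck N0).
  apply: subset_leq_card; apply/subsetP => g; rewrite !inE => /andP[gg _].
  by have := none g; rewrite gg /= => /negbFE.
have : ((16 * K) ^ K) ^ N < N ^ N by rewrite ltn_exp2r.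
move: cg; rewrite {1}/K mulSn expnD.
have : 0 < N ^ (k * N) by rewrite expn_gt0 N0.
clear; set x := N ^ N; set y := N ^ (k * N); set z := _ ^ N; set w := #|_|; clearbody x y z w.
nia.
Qed.

Definition embeds m n (h : graph m) (g : graph n) : Prop :=
  exists2 f : 'I_m -> 'I_n, injective f & forall i j, h (i, j) -> g (f i, f j).

Definition subgraphs_of (N : nat -> nat) (G : forall i, graph (N i)) : gset :=
  fun n h => if excluded_middle_informative (simple h /\ exists i, embeds h (G i))
             then true else false.

Lemma subgraphs_ofP N (G : forall i, graph (N i)) n (h : graph n) :
  reflect (simple h /\ exists i, embeds h (G i)) (subgraphs_of G h).
Proof. by rewrite /subgraphs_of; case: excluded_middle_informative => H; constructor. Qed.

Lemma subgraphs_of_monotone N (G : forall i, graph (N i)) : monotone (subgraphs_of G).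
Proof.
have down m n (f : 'I_m -> 'I_n) (g : graph n) (h : graph m) : injective f -> simple h ->
    (forall i j : 'I_m, h (i, j) -> g (f i, f j)) -> subgraphs_of G g -> subgraphs_of G h.
  move=> inj sh hg /subgraphs_ofP[_ [i [f' inj' gG]]]; apply/subgraphs_ofP; split=> //.
  exists i, (f' \o f) => [|a b /hg /gG //]; exact: inj_comp.
split=> //; split=> [n g /subgraphs_ofP[]//|n s g Hg].
have [sg _] := subgraphs_ofP _ _ Hg.
by apply: down (@perm_inj _ s) _ _ Hg => i j; rewrite !ffunE //; exact: sg.
Qed.

Lemma monotone_hereditary C : monotone C -> hereditary C.
Proof.
case=> cC mC; split=> // m n f g inj Cg.
apply: (mC _ _ f g) => // i j; last by rewrite ffunE.
by rewrite !ffunE; exact: (cC.1 _ _ Cg).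
Qed.

(** * Counting isomorphism classes *)

Lemma isoP n (g h : graph n) : reflect (exists s : {perm 'I_n}, h = pullback s g) (iso g h).
Proof. by apply: (iffP existsP) => -[s /eqP E]; exists s; rewrite E. Qed.

Lemma iso_sym n (g h : graph n) : iso g h -> iso h g.
Proof.
case/isoP=> s ->; apply/isoP; exists (s^-1)%g.
by apply/ffunP => -[i j]; rewrite !ffunE /= !permKV.
Qed.

Lemma iso_trans n (g h k : graph n) : iso g h -> iso h k -> iso g k.
Proof.
case/isoP=> s -> /isoP[t ->]; apply/isoP; exists (t * s)%g.
by apply/ffunP => -[i j]; rewrite !ffunE /= !permM.
Qed.

(** [Q] meets every isomorphism class in [C], so the classes of its members exhaust all of them. *)
Lemma unlabeled_count_le (C : gset) n (Q : {set graph n}) :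
  (forall g, C n g -> exists2 h, h \in Q & iso g h) -> unlabeled_count C n <= #|Q|.
Proof.
move=> H; pose cls (g : graph n) := [set h : graph n | C n h & iso g h].
apply: leq_trans (leq_imset_card cls _); apply: subset_leq_card.
apply/subsetP => _ /imsetP[g + ->]; rewrite inE => /H[h hQ gh].
apply/imsetP; exists h => //; apply/setP => k; rewrite !inE; congr andb.
by apply/idP/idP; apply: iso_trans => //; exact: iso_sym.
Qed.

Lemma locally_acyclic_le L L' n (g : graph n) :
  L' <= L -> locally_acyclic L g -> locally_acyclic L' g.
Proof.
move=> le /locally_acyclicP H; apply/locally_acyclicP => S S0 SL; apply: H => //.
exact: leq_trans le.
Qed.

(** Breadth-first ordered members represent all classes. The forests among them give the first
    summand; the others all embed in one common host and give the second. *)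
Lemma unlabeled_count_subgraphs_of d B (len : nat -> nat) (G : forall i, graph (B ^ len i)) n :
  0 < d -> 1 < B -> (forall i, 0 < len i) -> (forall i, B ^ len i < len i.+1) ->
  (forall i, good d (len i) (G i)) ->
  unlabeled_count (subgraphs_of G) n <= 2 ^ (n + n) + (4 * d * 2 ^ d * B) ^ n.
Proof.
move=> d0 B1 len0 lenS goodG.
have exQ (h : graph n) : exists b : bool, b <-> subgraphs_of G h /\ exists p, bfs_ordered h p.
  by case: (excluded_middle_informative (subgraphs_of G h /\ exists p, bfs_ordered h p));
    [exists true|exists false].
have [inQ inQP] := fin_all_exists exQ.
pose Q := [set h | inQ h]; pose A := [set h : graph n | locally_acyclic n h].
have QP h : h \in Q -> subgraphs_of G h /\ exists p, bfs_ordered h p.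
  by rewrite inE => /inQP.
apply: (@leq_trans #|Q|).
  apply: unlabeled_count_le => g Cg; have [s [p hp]] := bfs_exists g.
  exists (pullback s g); last by apply/isoP; exists s.
  rewrite inE; apply/inQP; split; last by exists p.
  by have [[_ perm_closed] _] := subgraphs_of_monotone G; exact: perm_closed.
rewrite -(cardsID A Q); apply: leq_add.
  apply: card_bfs_forests => h; rewrite inE => /andP[/QP[/subgraphs_ofP[sh _] hp]].
  by rewrite inE.
(* If [n < len i], local acyclicity of the host would make [h] a forest; the upper bound is
   injectivity of the embedding. *)
have window h : h \in Q :\: A -> exists2 i, len i <= n <= B ^ len i & embeds h (G i).
  rewrite !inE => /andP[/negP nA /inQP[/subgraphs_ofP[_ [i hG]] _]]; exists i => //.
  have [f inj hg] := hG; apply/andP; split.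
    rewrite leqNgt; apply/negP => ni; apply: nA; apply: locally_acyclic_le (ltnW ni) _.
    by apply: locally_acyclic_embed inj hg _; have /and3P[] := goodG i.
  by have := leq_card f inj; rewrite !card_ord.
have [->|/set0Pn[h0 /window[i /andP[lo hi] _]]] := eqVneq (Q :\: A) set0.
  by rewrite cards0.
have len_mono a b : a < b -> B ^ len a < len b.
  elim: b => // b IH; rewrite ltnS leq_eqVlt => /orP[/eqP -> //|/IH ab].
  exact: ltn_trans ab (ltn_trans (ltn_expl _ B1) (lenS b)).
apply: leq_trans (card_bfs_subgraphs d0 (len0 i) (goodG i) _) _ => [h hQ|].
  have [i' /andP[lo' hi'] hG] := window h hQ.
  (* If [i < i'], then [B ^ len i < len i' <= n <= B ^ len i], which is absurd; the other order is
     symmetric. *)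
  have ii' : i' = i.
    by case: (ltngtP i i') => // /len_mono;
      [have := leq_trans lo' hi|have := leq_trans lo hi']; lia.
  by move: hQ; rewrite inE => /andP[_ /QP[/subgraphs_ofP[sh _] hp]]; split=> //; rewrite -ii'.
(* The host has [B ^ len i] vertices, and [len i * (n %/ len i) <= n] bounds the root addresses by
   [B ^ n]. *)
rewrite addnn -mul2n expnM -!expnMn -expnM.
apply: (@leq_trans ((2 ^ 2 * d * 2 ^ d) ^ n * B ^ n)); last by rewrite -expnMn.
rewrite leq_mul2l; apply/orP; right.
by apply: leq_pexp2l; [exact: ltnW|rewrite mulnC; exact: leq_divM].
Qed.

Theorem theorem1p2 :
  forall (c : R), (0 < c)%R ->
  forall F : nat -> gset, (forall i, c_factorial c (F i)) ->
  exists C : gset, monotone C /\ tiny C /\ forall i, ~ subclass C (F i).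
Proof.
move=> c _ F HF; have [d [B [d0 B1 exG]]] := exists_good_notin c.
pose len := fix len i := if i is i'.+1 then (B ^ len i').+1 else 1.
have len0 i : 0 < len i by case: i.
have lenS i : B ^ len i < len i.+1 by exact: ltnSn.
have GP i := xchooseP (exG (len i) (F i) (len0 i) (HF i)).
pose G i : graph (B ^ len i) := xchoose (exG (len i) (F i) (len0 i) (HF i)).
have goodG i : good d (len i) (G i) by have /andP[] := GP i.
have notF i : ~~ F i _ (G i) by have /andP[] := GP i.
exists (subgraphs_of G); split; first exact: subgraphs_of_monotone.
split; last first.
  move=> i sub; move/negP: (notF i); apply; apply: sub; apply/subgraphs_ofP; split.
    by have /and3P[/simpleP] := goodG i.
  by exists i, (fun x => x).
split; first exact/monotone_hereditary/subgraphs_of_monotone.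
(* For [n > 0], [4 ^ n + M ^ n <= 2 * M ^ n <= (2 * M) ^ n]. For [n = 0] the last inequality fails,
   but there is only one graph. *)
pose M := 4 * d * 2 ^ d * B; exists (INR (2 * M)) => n.
rewrite -INR_expn; apply/le_INR/leP.
case: (posnP n) => [->|n0].
  apply: leq_trans (leq_imset_card _ _) _; apply: leq_trans (max_card _) _.
  by rewrite card_ffun card_prod card_ord card_bool.
have M4 : 4 <= M.
  have d2 : 0 < 2 ^ d by rewrite expn_gt0.
  by rewrite /M; move: d0 B1 d2; clear; set e := 2 ^ d; clearbody e; nia.
have count := unlabeled_count_subgraphs_of n d0 B1 len0 lenS goodG.
apply: (leq_trans count).
apply: (@leq_trans (2 * M ^ n)).
  by rewrite mul2n -addnn leq_add2r addnn -mul2n expnM leq_exp2r.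
by rewrite expnMn leq_mul2r -{1}[2]expn1 leq_pexp2l ?orbT.
Qed.
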